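(* Let $n\ge 2$ and $r\le -1$, and let $U_1,\dots,U_n$ be random variables each uniformly distributed on $(0,1)$. If $(U_1,\dots,U_n)$ is negatively upper orthant dependent, then $M^{\mathbf w}_{r}(U_1,\dots,U_n)$ is strictly sub-uniform for all $\mathbf w\in\Delta_n^+$.
   Context: $\Delta_n=\{(w_1,\dots,w_n)\in[0,1]^n: w_1+\dots+w_n=1\}$ and $\Delta_n^+=\Delta_n\cap(0,1)^n$. For $r\in\mathbb R\setminus\{0\}$ and $\mathbf w=(w_1,\dots,w_n)\in\Delta_n$, the weighted $r$-mean is $M^{\mathbf w}_r(u_1,\dots,u_n)=(w_1u_1^r+\dots+w_nu_n^r)^{1/r}$ for $(u_1,\dots,u_n)\in(0,\infty)^n$. A random vector $(X_1,\dots,X_n)$ is negatively upper orthant dependent (NUOD) if for all $x_1,\dots,x_n\in\mathbb R$, $\mathbb P(X_1>x_1,\dots,X_n>x_n)\le\prod_{i=1}^n\mathbb P(X_i>x_i)$. A non-negative random variable $X$ is strictly sub-uniform if $\mathbb P(X\le p)>p$ for all $p\in(0,1)$. *)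

(* Defs.v *)
From HB Require Import structures.
From mathcomp Require Import all_boot all_order all_algebra.
From mathcomp Require Import all_classical all_reals all_analysis.
From mathcomp Require Import measurable_realfun.

Set Implicit Arguments.
Unset Strict Implicit.
Unset Printing Implicit Defensive.

Import Order.TTheory GRing.Theory Num.Theory.
Import numFieldNormedType.Exports.

Local Open Scope classical_set_scope.
Local Open Scope ring_scope.

Definition simplex (R : realType) (n : nat) : set ('I_n -> R) :=
  [set w | (forall i, 0 <= w i <= 1) /\ \sum_(i < n) w i = 1].

Definition open_simplex (R : realType) (n : nat) : set ('I_n -> R) :=
  @simplex R n `&` [set w | forall i, 0 < w i < 1].

(* The mean of [u] is meant for [r != 0] and positive [u i]. Elsewhere [powR]
   takes conventional values ([0 `^ r = 0] for [r != 0], and [a `^ r = 1] for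
   [a < 0]). *)
Definition weighted_mean (R : realType) (n : nat) (r : R)
    (w u : 'I_n -> R) : R :=
  (\sum_(i < n) w i * u i `^ r) `^ r^-1.

Definition weighted_mean_rv (d : measure_display) (T : measurableType d)
    (R : realType) (n : nat) (P : probability T R) (r : R) (w : 'I_n -> R)
    (U : 'I_n -> {RV P >-> R}) : T -> R :=
  fun t => weighted_mean r w (fun i => U i t).

Lemma measurable_weighted_mean_rv (d : measure_display) (T : measurableType d)
    (R : realType) (n : nat) (P : probability T R) (r : R) (w : 'I_n -> R)
    (U : 'I_n -> {RV P >-> R}) :
  measurable_fun setT (weighted_mean_rv r w U).
Proof.
apply: (@measurableT_comp _ _ _ _ _ _ (@powR R ^~ r^-1)) => //.
apply: measurable_sum => i; apply: measurable_funM => //.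
exact: (@measurableT_comp _ _ _ _ _ _ (@powR R ^~ r)).
Qed.

HB.instance Definition _ (d : measure_display) (T : measurableType d)
    (R : realType) (n : nat) (P : probability T R) (r : R) (w : 'I_n -> R)
    (U : 'I_n -> {RV P >-> R}) :=
  isMeasurableFun.Build _ _ _ _ (weighted_mean_rv r w U)
    (measurable_weighted_mean_rv r w U).

(* Only the law is constrained: [X] takes values in ]0, 1[ almost surely, and
   [uniform_prob] on [0, 1] is also the uniform law on ]0, 1[. The equality is
   restricted to measurable sets because both sides are total set functions. *)
Definition uniform01 (d : measure_display) (T : measurableType d)
    (R : realType) (P : probability T R) (X : {RV P >-> R}) : Prop :=
  forall A : set R, measurable A ->
    distribution P X A = uniform_prob (@ltr01 R) A.
Arguments uniform01 {d T R} P X.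

Definition NUOD (d : measure_display) (T : measurableType d) (R : realType)
    (n : nat) (P : probability T R) (X : 'I_n -> {RV P >-> R}) : Prop :=
  forall x : 'I_n -> R,
    (P [set t | forall i, (x i < X i t)%R]
     <= \prod_(i < n) P [set t | (x i < X i t)%R])%E.
Arguments NUOD {d T R n} P X.

Definition strictly_sub_uniform (d : measure_display) (T : measurableType d)
    (R : realType) (P : probability T R) (X : {RV P >-> R}) : Prop :=
  (forall t, 0 <= X t) /\
  (forall p : R, 0 < p < 1 -> (p%:E < P [set t | (X t <= p)%R])%E).
Arguments strictly_sub_uniform {d T R} P X.

(* Main.v *)
Require Import Defs.
From HB Require Import structures.
From mathcomp Require Import all_boot all_order all_algebra.
From mathcomp Require Import all_classical all_reals all_analysis.
From mathcomp Require Import measurable_realfun.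
From mathcomp Require Import ring lra.

(** Write [M] for the weighted mean, let [0 < p < 1], and bound the probability
    of [p < M] strictly by [1 - p].

    As [r <= -1], [M] is at most the harmonic mean [H] of the [U i]
    ([weighted_mean_le_harmonic]).  If [p < H], then
    [\sum_j w j / U j < p^-1]; since [U j <= 1], every term [j != i] of this sum
    is at least [w j], so the term [w i / U i] is less than
    [p^-1 - (1 - w i)], that is,
    [U i > x i] with [x i = w i * p / (1 - p + w i * p)] ([harmonic_gt]).
    Thus [p < M] is almost surely contained in the upper orthant
    [forall i, x i < U i], which is the only kind of event that negative upper
    orthant dependence controls: its probability is at most
    [\prod_i (1 - x i)], by uniformity of the margins.

    Finally [(1 - x i)^-1 = 1 + w i * p / (1 - p)].  Expanding the product of
    these factors gives [1 + \sum_i w i * p / (1 - p) = (1 - p)^-1] plus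
    cross terms, which are positive as soon as there are two factors; hence
    [\prod_i (1 - x i) < 1 - p] ([prod_survival_lt]).  The cross terms are where
    the strictness comes from. *)

Set Implicit Arguments.
Unset Strict Implicit.
Unset Printing Implicit Defensive.

Import Order.TTheory GRing.Theory Num.Theory.
Import numFieldNormedType.Exports.

Local Open Scope classical_set_scope.
Local Open Scope ring_scope.

(** Bernoulli's inequality for real exponents: the convex function
    [t |-> t `^ s] lies above its tangent at [1].  Written as
    [t * t `^ (s - 1)], it follows from [1 + x <= expR x] and
    [1 - t^-1 <= ln t]. *)
Lemma powR_ge1Dx (R : realType) (s t : R) :
  1 <= s -> 0 < t -> 1 + s * (t - 1) <= t `^ s.
Proof.
move=> s1 t0.
have -> : t `^ s = t * t `^ (s - 1) by rewrite mulr_powRB1 ?ltW//; lra.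
have lnt : 1 - t^-1 <= ln t.
  have := @le_ln1Dx R (t^-1 - 1).
  have -> : 1 + (t^-1 - 1) = t^-1 by ring.
  rewrite lnV ?posrE// => h.
  have t'0 : 0 < t^-1 by rewrite invr_gt0.
  have := h _; lra.
have -> : 1 + s * (t - 1) = t * (1 + (s - 1) * (1 - t^-1)).
  by field; rewrite gt_eqF.
rewrite ler_pM2l// /powR gt_eqF//.
apply: le_trans (expR_ge1Dx _).
by rewrite lerD2l ler_wpM2l//; lra.
Qed.

Lemma sum_ratio_gt0 (R : realType) (n : nat) (w u : 'I_n -> R) :
  (forall i, 0 <= w i) -> \sum_(i < n) w i = 1 -> (forall i, 0 < u i) ->
  0 < \sum_(i < n) w i / u i.
Proof.
move=> w0 w1 u0.
rewrite lt_neqAle sumr_ge0 ?andbT; last by move=> i _; rewrite divr_ge0// ltW.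
apply/eqP => /esym/eqP.
rewrite psumr_eq0; last by move=> i _; rewrite divr_ge0// ltW.
move=> /allP h.
have : \sum_(i < n) w i = 0.
  apply: big1 => i _; have /= := h i (mem_index_enum _).
  by rewrite mulf_eq0 invr_eq0 (gt_eqF (u0 i)) orbF => /eqP.
by rewrite w1 => /eqP; rewrite oner_eq0.
Qed.

(** Jensen's inequality for [t |-> t `^ (- r)], in a form that needs only the
    tangent at [1]: after scaling by the harmonic mean [H], the numbers
    [H / u i] have weighted arithmetic mean [1], so the tangent bound of
    [powR_ge1Dx] averages to the constant [1]. *)
Lemma weighted_mean_le_harmonic (R : realType) (n : nat) (r : R)
    (w u : 'I_n -> R) :
  r <= -1 -> (forall i, 0 <= w i) -> \sum_(i < n) w i = 1 ->
  (forall i, 0 < u i) ->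
  weighted_mean r w u <= (\sum_(i < n) w i / u i)^-1.
Proof.
move=> r1 w0 w1 u0.
have S0 := sum_ratio_gt0 w0 w1 u0; set H := _^-1.
have H0 : 0 < H by rewrite invr_gt0.
pose s := - r; have s1 : 1 <= s by rewrite /s; lra.
have sN0 : s != 0 by rewrite gt_eqF//; lra.
pose S := \sum_(i < n) w i * u i `^ r.
have HS : 1 <= H `^ s * S.
  have -> : H `^ s * S = \sum_(i < n) w i * (H / u i) `^ s.
    rewrite /S big_distrr; apply: eq_bigr => i _ /=.
    rewrite powRM ?invr_ge0 ?ltW//.
    by rewrite -[(u i)^-1]powR_inv1 ?ltW// -powRrM /s mulN1r opprK; ring.
  (* The tangent bounds average to 1 because w sums to 1 and H is the inverse
     of the sum of the w i / u i. *)
  have -> : 1 = \sum_(i < n) w i * (1 + s * (H / u i - 1)).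
    transitivity ((1 - s) * \sum_(i < n) w i
                  + s * (H * \sum_(i < n) w i / u i)).
      by rewrite w1 mulVf ?gt_eqF//; ring.
    rewrite !big_distrr -big_split; apply: eq_bigr => i _ /=; ring.
  apply: ler_sum => i _; apply: ler_wpM2l => //.
  by apply: powR_ge1Dx; rewrite ?divr_gt0.
have Hs0 : 0 < H `^ s by rewrite powR_gt0.
have SS0 : 0 < S by rewrite -(pmulr_rgt0 _ Hs0); lra.
have -> : weighted_mean r w u = S^-1 `^ s^-1.
  rewrite /weighted_mean -/S /s -[S^-1]powR_inv1 ?ltW//.
  by rewrite -powRrM invrN mulN1r opprK.
have -> : H = (H `^ s) `^ s^-1 by rewrite -[RHS]powRrM mulfV// powRr1// ltW.
apply: ge0_ler_powR; rewrite ?nnegrE ?invr_ge0 ?powR_ge0 ?(ltW SS0)//.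
  by lra.
by rewrite -[S^-1]mul1r ler_pdivrMr.
Qed.

(** Passes from the harmonic mean to an orthant: in [\sum_j w j / u j < p^-1]
    the terms [j != i] cannot be smaller than [w j], which leaves the single
    term [w i / u i] less than [p^-1 - (1 - w i)]. *)
Lemma harmonic_gt (R : realType) (n : nat) (w u : 'I_n -> R) (p : R) :
  (forall i, 0 < w i) -> \sum_(i < n) w i = 1 ->
  (forall i, 0 < u i <= 1) -> 0 < p < 1 ->
  p < (\sum_(i < n) w i / u i)^-1 ->
  forall i, w i * p / (1 - p + w i * p) < u i.
Proof.
move=> w0 w1 u01 /andP[p0 p1] + i.
have u0 j : 0 < u j by case/andP: (u01 j).
have S0 := sum_ratio_gt0 (fun j => ltW (w0 j)) w1 u0.
rewrite -(invrK p) ltf_pV2 ?posrE ?invr_gt0// invrK => Sp.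
(* As the weights sum to 1, the left-hand side is the total weight of the
   indices other than i. *)
have rest : 1 - w i <= \sum_(j < n | j != i) w j / u j.
  rewrite -w1 (bigD1 i)//= addrAC subrr add0r.
  apply: ler_sum => j _; rewrite ler_pdivlMr// ler_piMr ?(ltW (w0 j))//.
  by case/andP: (u01 j).
rewrite (bigD1 i)//= in Sp.
have wp0 : 0 < w i * p by rewrite mulr_gt0.
have {Sp rest} : w i / u i < p^-1 - 1 + w i by lra.
have -> : p^-1 - 1 + w i = (1 - p + w i * p) / p.
  by field; rewrite gt_eqF.
rewrite ltr_pdivrMr// mulrAC ltr_pdivlMr// => h.
by rewrite ltr_pdivrMr 1?mulrC; lra.
Qed.

Lemma prod_1Dx_ge (R : realDomainType) (n : nat) (a : 'I_n -> R) :
  (forall i, 0 <= a i) ->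
  1 + \sum_(i < n) a i <= \prod_(i < n) (1 + a i).
Proof.
elim: n a => [|n IH] a a0; first by rewrite !big_ord0 addr0.
rewrite !big_ord_recl.
have := IH (fun i => a (lift ord0 i)) (fun i => a0 _).
have : 0 <= \sum_(i < n) a (lift ord0 i) by apply: sumr_ge0.
have := a0 ord0.
set A := a ord0; set S := \sum_(i < n) _; set Q := \prod_(i < n) _.
move=> A0 S0 QS.
apply: (@le_trans _ _ ((1 + A) * (1 + S))); first by nra.
by rewrite ler_wpM2l// addr_ge0.
Qed.

(** Two factors are needed for a positive cross term: the first one is split
    off and the remaining product, which is not empty, is bounded by
    [prod_1Dx_ge]. *)
Lemma prod_1Dx_gt (R : realDomainType) (n : nat) (a : 'I_n -> R) :
  (2 <= n)%N -> (forall i, 0 < a i) ->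
  1 + \sum_(i < n) a i < \prod_(i < n) (1 + a i).
Proof.
case: n a => [|[|n]]// a _ a0.
rewrite [X in 1 + X < _]big_ord_recl [ltRHS]big_ord_recl.
have := prod_1Dx_ge (fun i => ltW (a0 (lift ord0 i))).
have : 0 < \sum_(i < n.+1) a (lift ord0 i).
  by rewrite big_ord_recl ltr_pwDl// sumr_ge0// => i _; exact: ltW.
have := a0 ord0.
set A := a ord0; set S := \sum_(i < _) _; set Q := \prod_(i < _) _.
move=> A0 S0 QS.
apply: (@lt_le_trans _ _ ((1 + A) * (1 + S))); first by nra.
by rewrite ler_wpM2l// addr_ge0// ltW.
Qed.

(** The reciprocal of each factor is [1 + a i] with
    [a i = w i * (p / (1 - p))], and [1 + \sum_i a i = (1 - p)^-1] because the
    weights sum to [1]; so this is [prod_1Dx_gt] read on reciprocals. *)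
Lemma prod_survival_lt (R : realType) (n : nat) (w : 'I_n -> R) (p : R) :
  (2 <= n)%N -> (forall i, 0 < w i) -> \sum_(i < n) w i = 1 ->
  0 < p < 1 ->
  \prod_(i < n) (1 - w i * p / (1 - p + w i * p)) < 1 - p.
Proof.
move=> n2 w0 w1 /andP[p0 p1].
have q0 : 0 < 1 - p by lra.
pose a i := w i * (p / (1 - p)).
have a0 i : 0 < a i by rewrite mulr_gt0// divr_gt0.
have := prod_1Dx_gt n2 a0.
rewrite /a -big_distrl/= w1.
have -> : 1 + 1 * (p / (1 - p)) = (1 - p)^-1 by field; rewrite gt_eqF.
have -> : \prod_(i < n) (1 - w i * p / (1 - p + w i * p)) =
          (\prod_(i < n) (1 + w i * (p / (1 - p))))^-1.
  rewrite -prodfV; apply: eq_bigr => i _.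
  have wp : 0 < w i * p by rewrite mulr_gt0.
  field; apply/andP; split; rewrite gt_eqF//; lra.
move=> h; rewrite -[ltRHS]invrK ltf_pV2// ?posrE ?invr_gt0//.
by apply: lt_trans h; rewrite invr_gt0.
Qed.

Section uniform_margins.
Context d (T : measurableType d) (R : realType) (P : probability T R).

Lemma preimage_gt (X : {RV P >-> R}) (x : R) :
  [set t | x < X t] = X @^-1` `]x, +oo[%classic.
Proof. by apply/seteqP; split => t /=; rewrite in_itv/= andbT. Qed.

Lemma measurable_gt (X : {RV P >-> R}) (x : R) :
  measurable [set t | x < X t].
Proof.
by rewrite preimage_gt -[X in measurable X]setTI; exact: measurable_funP.
Qed.

Lemma uniform01_survival (X : {RV P >-> R}) (x : R) :
  uniform01 P X -> 0 <= x <= 1 ->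
  P [set t | x < X t] = (1 - x)%:E.
Proof.
move=> UX /andP[x0 x1].
rewrite preimage_gt.
have := UX `]x, +oo[%classic (measurable_itv _).
rewrite /distribution /pushforward => ->.
rewrite /uniform_prob integral_uniform_pdf.
have -> : `]x, +oo[%classic `&` `[0, 1]%classic = `]x, 1]%classic.
  apply/seteqP; split => y /=; rewrite !in_itv/= andbT.
    by case=> -> /andP[].
  by move=> /andP[xy ->]; rewrite xy (le_trans x0 (ltW xy)).
rewrite (eq_integral (cst 1%E)); last first.
  move=> y; rewrite inE/= in_itv/= => /andP[xy y1].
  by rewrite /uniform_pdf y1 (le_trans x0 (ltW xy)) subr0 invr1.
rewrite integral_cst//= mul1e lebesgue_measure_itv/= lte_fin.
case: ltP => // x1'; have -> : x = 1 by apply/eqP; rewrite eq_le x1.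
by rewrite subrr.
Qed.

(** The probabilities of both exceptional events, [X <= 0] and [1 < X], are read
    off the survival function at the end points [0] and [1].  The bounds hold only almost surely,
    since the law does not constrain [X] pointwise. *)
Lemma uniform01_ae_bound (X : {RV P >-> R}) :
  uniform01 P X -> \forall t \ae P, 0 < X t <= 1.
Proof.
move=> UX.
have : P.-negligible (~` [set t | 0 < X t] `|` [set t | 1 < X t]).
  apply: negligibleU.
    apply/negligibleP; first exact/measurableC/measurable_gt.
    have := probability_setC P (measurable_gt X 0).
    by rewrite uniform01_survival ?lexx ?ler01// subr0 subee.
  apply/negligibleP; first exact: measurable_gt.
  by have := @uniform01_survival X 1 UX; rewrite ler01 lexx subrr; exact.
apply: negligibleS => t /= /negP; rewrite negb_and -ltNge.
by move=> /orP[/negP|]; [left|right].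
Qed.

Lemma ae_le_measure (A B : set T) : measurable A -> measurable B ->
  (\forall t \ae P, A t -> B t) -> (P A <= P B)%E.
Proof.
move=> mA mB [N [mN N0 AB]].
rewrite -(measureU0 mB mN N0); apply: le_measure; rewrite ?inE//.
  exact: measurableU.
move=> t At; have [Bt|nBt] := pselect (B t); [by left|right].
by apply: AB => /= /(_ At).
Qed.

End uniform_margins.

Theorem proposition4 (R : realType) (d : measure_display)
    (T : measurableType d) (P : probability T R) (n : nat) (r : R)
    (U : 'I_n -> {RV P >-> R}) :
  (2 <= n)%N -> r <= -1 ->
  (forall i, uniform01 P (U i)) ->
  NUOD P U ->
  forall w : 'I_n -> R, open_simplex w ->
    strictly_sub_uniform P (weighted_mean_rv r w U).
Proof.
move=> n2 r1 Uunif UN w [[_ w1] w01].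
have w0 i : 0 < w i by case/andP: (w01 i).
split=> [t|p p01]; first exact: powR_ge0.
have [p0 p1] := andP p01.
pose M := weighted_mean_rv r w U.
pose x i := w i * p / (1 - p + w i * p).
have x01 i : 0 <= x i <= 1.
  have wp : 0 < w i * p by rewrite mulr_gt0.
  by rewrite divr_ge0 ?ler_pdivrMr/=; lra.
have -> : [set t | M t <= p] = ~` [set t | p < M t].
  by apply/seteqP; split => t /=; rewrite leNgt => /negP.
rewrite probability_setC; last exact: measurable_gt.
have mall : measurable [set t | forall i, x i < U i t].
  have -> : [set t | forall i, x i < U i t] =
            \bigcap_(i in [set: 'I_n]) [set t | x i < U i t].
    by apply/seteqP; split => t /= h i; have := h i; exact.
  apply: fin_bigcap_measurable => [|i _]; last exact: measurable_gt.
  exact: finite_finset.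
have tail : (P [set t | (p < M t)%R] < (1 - p)%:E)%E.
  apply: (@le_lt_trans _ _ (P [set t | forall i, x i < U i t])).
    apply: ae_le_measure => //; first exact: measurable_gt.
    have : \forall t \ae P, forall i, 0 < U i t <= 1.
      by apply: filter_forall => i; exact: uniform01_ae_bound.
    apply: filterS => t Ut /= pM.
    apply: harmonic_gt => //.
    apply: lt_le_trans pM _; apply: weighted_mean_le_harmonic => // i.
      exact: ltW.
    by case/andP: (Ut i).
  apply: le_lt_trans (UN x) _.
  under eq_bigr do rewrite uniform01_survival//.
  by rewrite prodEFin lte_fin prod_survival_lt.
have finM : P [set t | p < M t] \is a fin_num.
  exact/fin_num_measure/measurable_gt.
move: tail; rewrite -(fineK finM) -EFinB !lte_fin; lra.
Qed.
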